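(* Let $\mathfrak{n}$ be a real nilpotent Lie algebra with $\dim(\mathfrak{n})\ge 3$ and Lie bracket $\mu$. Then there exists a left-invariant pseudo-Riemannian metric on the corresponding nilmanifold (the Lie group with Lie algebra $\mathfrak{n}$), equivalently a non-degenerate symmetric bilinear form $g$ on $\mathfrak{n}$, of signature $(p,p)$ if $\dim(\mathfrak{n})=2p$ is even, and of signature $(p,p+1)$ if $\dim(\mathfrak{n})=2p+1$ is odd, such that $\mu$ is in the null cone $\mathcal{N}$ of the action of the orthogonal group of $g$.
   Context: All Lie algebras are real and finite-dimensional. Left-invariant pseudo-Riemannian metrics on a Lie group correspond to non-degenerate symmetric bilinear forms on its Lie algebra. Given such a form $g$ of signature $(p,q)$ on a real vector space $V$ of dimension $p+q$, the group $O(p,q)$ of linear isometries of $(V,g)$ acts on $\mathcal{V}:=V\otimes\wedge^2V^*$ (skew-symmetric bilinear maps $V\times V\to V$) by $(A\cdot\mu)(X,Y)=A^{-1}(\mu(AX,AY))$. The null cone is $$\mathcal{N}=\{\mu\in\mathcal{V}:\ \mu\text{ satisfies the Jacobi identity and } 0\in\overline{O(p,q)\cdot\mu}\},$$ where the closure of the orbit is taken in the usual topology of the finite-dimensional real vector space $\mathcal{V}$. Here $V$ is the underlying vector space of $\mathfrak{n}$. *)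

(* Defs.v *)
From HB Require Import structures.
From mathcomp Require Import all_boot all_order all_algebra sesquilinear.
From mathcomp Require Import all_classical all_reals all_analysis.

Set Implicit Arguments.
Unset Strict Implicit.
Unset Printing Implicit Defensive.

Import Order.TTheory GRing.Theory Num.Theory.
Import numFieldNormedType.Exports.

Local Open Scope classical_set_scope.
Local Open Scope ring_scope.

Section LieAlgebra.
Variables (R : realType) (V : vectType R).

(* The space of bilinear maps V x V -> V, as maps V -> End(V). *)
Definition bilmap := 'Hom(V, 'End(V)).
Implicit Types mu : bilmap.

Definition skew_symmetric mu := forall x y, mu x y = - mu y x.

Definition jacobi mu :=
  forall x y z, mu x (mu y z) + mu y (mu z x) + mu z (mu x y) = 0.

Definition lie_bracket mu := skew_symmetric mu /\ jacobi mu.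

(* [V, U], the span of the brackets mu x y with x in V and y in U; by
   linearity in x it is enough to let x range over a basis (see ad_imgP). *)
Definition ad_img mu (U : {vspace V}) : {vspace V} :=
  (\sum_(e <- vbasis {:V}) (mu e @: U))%VS.

Lemma ad_imgP mu (U W : {vspace V}) :
  reflect (forall x y, y \in U -> mu x y \in W) (ad_img mu U <= W)%VS.
Proof.
apply: (iffP idP) => [sUW x y yU|mUW].
  rewrite (coord_vbasis (memvf x)) linear_sum sum_lfunE memv_suml// => i _.
  rewrite linearZ lfunE /= memvZ//; apply: (subvP sUW); rewrite /ad_img.
  rewrite (big_nth 0) big_mkord.
  have lti : (i < size (vbasis {:V}))%N by rewrite size_tuple.
  by apply: (subvP (sumv_sup (Ordinal lti) _ (subvv _))); rewrite ?memv_img.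
rewrite /ad_img big_tnth; apply/subv_sumP => i _; apply/subvP => _ /memv_imgP[y yU ->].
exact: mUW.
Qed.

Definition lower_central mu k : {vspace V} := iter k (ad_img mu) fullv.

Definition nilpotent mu := exists k, lower_central mu k = 0%VS.

(* The usual topology of a finite-dimensional space W, transported from
   'rV[R]_(\dim {:W}) by the coordinates in a basis (any basis gives the same
   topology). *)
Definition fin_dim_top (W : vectType R) :=
  initial_topology (passmx.rVof (vbasis {:W})).

(* (A . mu)(x, y) = A^-1 (mu (A x) (A y)), see actE. *)
Definition act (A : 'End(V)) mu : bilmap :=
  linfun (fun x => A^-1 \o mu (A x) \o A)%VF.

Lemma actE A mu x y : act A mu x y = (A^-1)%VF (mu (A x) (A y)).
Proof.
rewrite /act; set f := (fun _ => _).
have fL : linear f.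
  move=> a u v; apply/lfunP => w.
  by rewrite /f /= !lfunE /= !lfunE /= !lfunE /= 2!linearP /= !lfunE /= lfunE /= linearP.
pose F := GRing.isLinear.Build _ _ _ _ f fL.
pose g : {linear V -> 'End(V)} := HB.pack f F.
by rewrite (_ : f = g)// lfunE /= /f !lfunE /= lfunE.
Qed.

Definition orthogonal_group (g : {symmetric V}) : set 'End(V) :=
  [set A | lker A == 0%VS /\ isometry g g A].

(* The orbit of a skew-symmetric mu lies in the subspace of skew-symmetric
   maps, which is closed and contains 0, so the closure may be taken in the
   space of all bilinear maps. *)
Definition null_cone (g : {symmetric V}) : set bilmap :=
  [set mu | lie_bracket mu /\
     closure ([set act A mu | A in orthogonal_group g] :
                set (fin_dim_top 'Hom(V, 'End(V)))) 0].

(* p counts the positive squares, q the negative ones. *)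
Definition has_signature (g : {symmetric V}) (p q : nat) :=
  exists2 e : (p + q).-tuple V, basis_of fullv e &
    forall i j : 'I_(p + q), g e`_i e`_j =
      if i != j then 0 else if (i < p)%N then 1 else -1.

End LieAlgebra.

(* Main.v *)
Require Import Defs.
From HB Require Import structures.
From mathcomp Require Import all_boot all_order all_algebra sesquilinear.
From mathcomp Require Import all_classical all_reals all_analysis.
From mathcomp Require Import ring zify.
Import Order.TTheory GRing.Theory Num.Theory.
Import numFieldNormedType.Exports.
Import passmx.
Set Implicit Arguments.
Unset Strict Implicit.

Local Open Scope classical_set_scope.
Local Open Scope ring_scope.

(* Refining the lower central series gives a basis e_0, ..., e_(n-1) in which
   [V, e_j] is spanned by the e_k with k > j. For the antidiagonal metric
   g(e_i, e_(n-1-i)) = -1 a diagonal map e_i |-> t^(w_i) e_i is an isometry as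
   soon as w_(n-1-i) = - w_i, and it multiplies the structure constant c_ij^k by
   t^(w_i + w_j - w_k). With w_i = 2^(n-1-i) - 2^i this exponent is positive
   whenever i, j < k and i <> j, so the orbit of mu tends to 0 as t -> 0+. *)

(** * Limits along a one-parameter family with positive weights *)

Lemma closure_fin_dim_top0 (R : realType) (W : vectType R) (I : finType)
    (s : I -> int) (nu : I -> W) (S : set W) :
  (forall i, s i <= 0 -> nu i = 0) ->
  (forall t : R, 0 < t -> S (\sum_i (t ^ s i) *: nu i)) ->
  closure (S : set (fin_dim_top W)) 0.
Proof.
move=> nu0 St B; rewrite nbhsE => -[_ [[U Uop <-]] /= U0 sUB].
(* Taking [|s i|] alters only terms with [nu i = 0] and turns the curve, read in coordinates, into a
   polynomial one, hence continuous even at 0. *)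
pose f (t : R) := \sum_i (t ^+ `|s i|) *: rVof (vbasis {:W}) (nu i).
have f0 : f 0 = rVof (vbasis {:W}) 0.
  rewrite linear0 /f big1// => i _; have [/nu0->|s_gt0] := leP (s i) 0.
    by rewrite linear0 scaler0.
  by rewrite expr0n absz_eq0 gt_eqF// scale0r.
have fc : continuous f.
  apply: continuous_big => [|i _ x]; first exact: add_continuous.
  by apply: cvgZr_tmp; exact: exprn_continuous.
(* The limit is taken from the right because [S] is only known to contain the curve for [t > 0]. *)
have : \forall t \near 0^'+, U (f t).
  apply: (cvg_at_right_filter (fc 0)); apply: open_nbhs_nbhs; split => //.
  by rewrite f0.
move=> fU.
have [t [t_gt0 Ut]] : exists t : R, 0 < t /\ U (f t).
  near (0 : R)^'+ => t; exists t; split; first by [].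
  by near: t.
exists (\sum_i (t ^ s i) *: nu i); split; first exact: St.
apply: sUB => /=; rewrite linear_sum /=; move: Ut; congr (U _).
apply: eq_bigr => i _; rewrite linearZ /=.
have [/nu0->|s_gt0] := leP (s i) 0; first by rewrite linear0 !scaler0.
by rewrite -[in RHS](gtz0_abs s_gt0).
Unshelve. all: by end_near.
Qed.

(** * A basis adapted to the lower central series *)

Section AdaptedBasis.
Variables (R : realType) (V : vectType R) (mu : bilmap V).

Lemma ad_imgS (U W : {vspace V}) : (U <= W)%VS -> (ad_img mu U <= ad_img mu W)%VS.
Proof.
move=> /subvP sUW; apply/ad_imgP => x y /sUW yW.
by have /ad_imgP := subvv (ad_img mu W); apply.
Qed.

Lemma lower_centralS k : (lower_central mu k.+1 <= lower_central mu k)%VS.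
Proof.
by elim: k => [|k IHk]; [exact: subvf | exact: (ad_imgS IHk)].
Qed.

Lemma adapted_basis : nilpotent mu ->
  exists2 e : (\dim {:V}).-tuple V, basis_of fullv e &
    forall x (j : 'I_(\dim {:V})), mu x e`_j \in <<drop j.+1 e>>%VS.
Proof.
case=> m mu0.
(* The induction climbs from the zero term [m] of the series up to the whole space, each time
   putting a basis [b] of a complement in front of [e]. *)
suff /(_ m (leqnn m)) [e] : forall k, (k <= m)%N ->
    exists2 e : seq V, basis_of (lower_central mu (m - k)) e &
      forall x j, (j < size e)%N -> mu x e`_j \in <<drop j.+1 e>>%VS.
  rewrite subnn => be nil_e.
  have se : size e = \dim {:V} by rewrite (size_basis (X := in_tuple e) be).
  exists (Tuple (introT eqP se)) => // x j.
  by rewrite nil_e//= se.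
elim=> [_|k IHk ltkm].
  by exists [::] => //; rewrite subn0 mu0 nil_basis.
have [e be nil_e] := IHk (ltnW ltkm).
have ek : (m - k = (m - k.+1).+1)%N by rewrite subnSK.
set U := lower_central mu (m - k.+1).
have sLU : (lower_central mu (m - k) <= U)%VS by rewrite ek lower_centralS.
pose b : seq V := vbasis (U :\: lower_central mu (m - k))%VS.
have bU : basis_of (U :\: lower_central mu (m - k)) b by exact: vbasisP.
exists (b ++ e).
  rewrite -[U](addv_idPl sLU) -addv_diff; apply: cat_basis => //.
  by apply/directv_addP; exact: capv_diff.
move=> x j; rewrite size_cat nth_cat drop_cat => ltj.
have [ltjb|lebj] := ltnP j (size b).
  (* Bracketing sends a term of the series into the next one, which [e] spans. *)
  have mb : mu x b`_j \in <<e>>%VS.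
    rewrite (span_basis be) ek.
    have /ad_imgP := subvv (ad_img mu U); apply.
    apply: (subvP (diffvSl _ (lower_central mu (m - k)))).
    by rewrite (basis_mem bU)// mem_nth.
  (* All of [e] survives the drop; if [j] is the last index of [b], exactly [e] remains. *)
  case: ltnP => _; first by rewrite span_cat (subvP (addvSr _ _)).
  by rewrite (_ : j.+1 - _ = 0)%N ?drop0//; apply/eqP; rewrite subn_eq0.
rewrite ltnNge (leq_trans lebj)//= subSn//; apply: nil_e.
by rewrite ltn_subLR.
Qed.

End AdaptedBasis.

(** * Coordinates, diagonal endomorphisms and their action on brackets *)

Section DiagonalAction.
Variables (R : realType) (V : vectType R) (n : nat) (e : n.-tuple V).
Hypothesis be : basis_of fullv e.

Let free_e : free e. Proof. exact: basis_free be. Qed.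

Let coordE x : x = \sum_i coord e i x *: e`_i.
Proof. exact: coord_basis be (memvf x). Qed.

Lemma coord_nth (i j : 'I_n) : coord e j e`_i = (i == j)%:R.
Proof. exact: coord_free. Qed.

Lemma coordP x y : (forall i, coord e i x = coord e i y) -> x = y.
Proof.
by move=> xy; rewrite (coordE x) (coordE y); apply: eq_bigr => i _; rewrite xy.
Qed.

Lemma coord_drop (v : V) (m : nat) (k : 'I_n) :
  v \in <<drop m e>>%VS -> (k < m)%N -> coord e k v = 0.
Proof.
(* As the kernel of the coordinate is a subspace, it suffices to test the spanning vectors, whose
   indices are at least [m > k]. *)
move=> vm km; pose f : 'Hom(V, R^o) := linfun (coord e k).
suff /subvP/(_ _ vm) : (<<drop m e>> <= lker f)%VS.
  by rewrite memv_ker lfunE => /eqP.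
apply/span_subvP => u /(nthP 0)[i]; rewrite size_drop size_tuple nth_drop.
rewrite ltn_subRL => lt_mi <-.
rewrite memv_ker lfunE /= (coord_nth (Ordinal lt_mi)) -val_eqE /= gtn_eqF//.
exact: leq_trans km (leq_addr _ _).
Qed.

Definition coord_proj (i : 'I_n) : 'End(V) :=
  linfun (fun x => coord e i x *: e`_i).

Lemma coord_projE i x : coord_proj i x = coord e i x *: e`_i.
Proof.
rewrite /coord_proj; set f := (fun _ => _).
have fL : linear f.
  by move=> a u v; rewrite /f linearP /= scalerDl scalerA.
pose F := GRing.isLinear.Build _ _ _ _ f fL.
pose g : {linear V -> V} := HB.pack f F.
by rewrite (_ : f = g)// lfunE.
Qed.

Definition diag_end (c : 'I_n -> R) : 'End(V) := \sum_i c i *: coord_proj i.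

Lemma diag_endE c x : diag_end c x = \sum_i c i *: coord_proj i x.
Proof. by rewrite sum_lfunE; apply: eq_bigr => i _; rewrite scale_lfunE. Qed.

Lemma coord_diag_end c x i : coord e i (diag_end c x) = c i * coord e i x.
Proof.
rewrite diag_endE -(coord_sum_free (fun i => c i * coord e i x) _ free_e).
by congr (coord e i _); apply: eq_bigr => j _; rewrite coord_projE scalerA.
Qed.

Lemma diag_endK a b : (forall i, a i * b i = 1) ->
  cancel (diag_end b) (diag_end a).
Proof.
by move=> ab x; apply: coordP => i; rewrite !coord_diag_end mulrA ab mul1r.
Qed.

Lemma diag_end_inv a b : (forall i, a i * b i = 1) ->
  lker (diag_end b) == 0%VS /\ (diag_end b)^-1%VF =1 diag_end a.
Proof.
move=> ab; have kb : lker (diag_end b) == 0%VS.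
  exact/lker0P/can_inj/diag_endK/ab.
split=> // x; rewrite -{1}[x](@diag_endK b a); last by move=> i; rewrite mulrC.
by rewrite lker0_lfunK.
Qed.

(** The part of [mu] carrying the single structure constant c_ij^k: two input indices, then the
    output index. *)
Definition bil_component (mu : bilmap V) (ijk : 'I_n * 'I_n * 'I_n) : bilmap V :=
  linfun (fun x => coord_proj ijk.2 \o mu (coord_proj ijk.1.1 x) \o
                   coord_proj ijk.1.2)%VF.

Lemma bil_componentE mu i j k x y :
  bil_component mu (i, j, k) x y =
  coord_proj k (mu (coord_proj i x) (coord_proj j y)).
Proof.
rewrite /bil_component; set f := (fun _ => _).
have fL : linear f.
  move=> a u v; apply/lfunP => w.
  rewrite /f/= !(lfunE, linearP) /= !(lfunE, linearP) /= !(lfunE, linearP) /=.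
  by rewrite !(lfunE, linearP).
pose F := GRing.isLinear.Build _ _ _ _ f fL.
pose g : {linear V -> 'End(V)} := HB.pack f F.
by rewrite (_ : f = g)// lfunE /= /f !lfunE /= lfunE.
Qed.

Lemma bil_sum (I J : finType) (mu : bilmap V) (X : I -> V) (Y : J -> V) :
  mu (\sum_i X i) (\sum_j Y j) = \sum_i \sum_j mu (X i) (Y j).
Proof.
by rewrite [mu _]linear_sum sum_lfunE; apply: eq_bigr => i _; rewrite linear_sum.
Qed.

(** The components are simultaneous eigenvectors of the diagonal maps: both inputs are scaled by
    [b], the output by the inverse family [a]. *)
Lemma act_diag_end a b mu : (forall i, a i * b i = 1) ->
  act (diag_end b) mu =
  \sum_ijk (b ijk.1.1 * b ijk.1.2 * a ijk.2) *: bil_component mu ijk.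
Proof.
move=> ab; apply/lfunP => x; apply/lfunP => y.
have [_ bV] := diag_end_inv ab.
rewrite actE bV [in RHS]sum_lfunE [in RHS]sum_lfunE.
transitivity (\sum_i \sum_j \sum_k (b i * b j * a k) *:
    coord_proj k (mu (coord_proj i x) (coord_proj j y))).
  rewrite !(diag_endE b) bil_sum linear_sum; apply: eq_bigr => i _.
  rewrite linear_sum; apply: eq_bigr => j _.
  rewrite [LHS]diag_endE; apply: eq_bigr => k _.
  rewrite [mu (_ *: _)]linearZ scale_lfunE [mu _ (_ *: _)]linearZ /=.
  rewrite [coord_proj k (_ *: _)]linearZ [X in _ *: (_ *: X)]linearZ /= !scalerA.
  by congr (_ *: _); ring.
rewrite pair_big /= pair_big /=; apply: eq_bigr => -[[i j] k] _ /=.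
by rewrite !scale_lfunE bil_componentE.
Qed.

End DiagonalAction.

(** * The antidiagonal metric and its signature *)

Section AntidiagonalForm.
Variables (R : realType) (V : vectType R) (n : nat) (e : n.-tuple V).
Hypothesis be : basis_of fullv e.

(** The sign affects the signature only for odd [n], where it makes the middle basis vector
    negative. *)
Definition antidiag_form (x y : V) : R :=
  - \sum_i coord e i x * coord e (rev_ord i) y.

Lemma antidiag_form_bilinear :
  bilinear_for (GRing.Scale.Law.clone _ _ *%R _)
    (GRing.Scale.Law.clone _ _ (idfun \; *%R) _) antidiag_form.
Proof.
split=> [z|z] a x y; rewrite /antidiag_form /= mulrN -opprD mulr_sumr -big_split.
  by congr (- _); apply: eq_bigr => i _ /=; rewrite linearP /=; ring.
by congr (- _); apply: eq_bigr => i _ /=; rewrite linearP /=; ring.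
Qed.

HB.instance Definition _ := bilinear_isBilinear.Build R V V R
  (GRing.Scale.Law.clone _ _ *%R _)
  (GRing.Scale.Law.clone _ _ (idfun \; *%R) _)
  antidiag_form antidiag_form_bilinear.

Lemma antidiag_formC x y :
  antidiag_form x y = (-1) ^+ false * idfun (antidiag_form y x).
Proof.
rewrite mul1r /= /antidiag_form (reindex_inj rev_ord_inj); congr (- _).
by apply: eq_bigr => i _; rewrite rev_ordK mulrC.
Qed.

HB.instance Definition _ := @isHermitianSesquilinear.Build R V false idfun
  antidiag_form antidiag_formC.

Definition antidiag : {symmetric V} := antidiag_form.

Lemma antidiagE x y :
  antidiag x y = - \sum_i coord e i x * coord e (rev_ord i) y.
Proof. by []. Qed.

Lemma antidiagC x y : antidiag x y = antidiag y x.
Proof. by have := antidiag_formC x y; rewrite mul1r. Qed.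

Lemma antidiagDZl (a b : R) x y z :
  antidiag (a *: x + b *: y) z = a * antidiag x z + b * antidiag y z.
Proof.
rewrite !antidiagE !mulrN -opprD !mulr_sumr -big_split; congr (- _).
by apply: eq_bigr => i _ /=; rewrite linearD !linearZ /=; ring.
Qed.

Lemma antidiag_suml (I : finType) (k : I -> R) (x : I -> V) z :
  antidiag (\sum_i k i *: x i) z = \sum_i k i * antidiag (x i) z.
Proof.
apply: (big_rec2 (fun v a => antidiag v z = a)) => [|i v a _ <-].
  exact: linear0l.
by rewrite -[v in LHS]scale1r antidiagDZl mul1r.
Qed.

Lemma antidiag_basis (i j : 'I_n) : antidiag e`_i e`_j = - (j == rev_ord i)%:R.
Proof.
rewrite antidiagE (bigD1 i)//= !(coord_nth be) eqxx mul1r.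
rewrite big1 ?addr0// => k ki; rewrite (coord_nth be) eq_sym (negPf ki).
by rewrite mul0r.
Qed.

(** Pairing [x] with the basis vector of index [rev_ord i] reads off its coordinate [i] up to
    sign. *)
Lemma antidiag_nondegenerate : nondegenerate antidiag.
Proof.
rewrite /nondegenerate -subv0; apply/subvP => x /orthovP xV.
rewrite memv0; apply/eqP; apply: (coordP be) => i; rewrite linear0.
have := xV x e`_(rev_ord i) (memv_line x) (memvf _).
rewrite antidiagE (bigD1 i)// (coord_nth be) eqxx mulr1.
rewrite big1 => [|k /= ki]; last first.
  rewrite (_ : coord e (rev_ord k) _ = (rev_ord i == rev_ord k)%:R).
    by rewrite (inj_eq rev_ord_inj) eq_sym (negPf ki) mulr0.
  exact: (coord_nth be (rev_ord i)).
by rewrite /= addr0 => /eqP; rewrite oppr_eq0 => /eqP.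
Qed.

(* An orthogonal basis of each hyperbolic plane <e_i, e_(n-1-i)>; for odd n the
   middle vector is paired with itself and negative, whence q = p + 1. *)
Definition hyperbolic_coef (i : 'I_n) : R * R :=
  if (i < rev_ord i)%N then (1, - 2^-1)
  else if (rev_ord i < i)%N then (2^-1, 1) else (1, 0).

Definition hyperbolic_vec (i : 'I_n) : V :=
  (hyperbolic_coef i).1 *: e`_i + (hyperbolic_coef i).2 *: e`_(rev_ord i).

(** Off the middle, a e_i + b e_(n-1-i) has square -2ab, which is 1 for (1, -1/2) and -1 for (1/2,
    1); the cross terms of these two vectors cancel. *)
Lemma antidiag_hyperbolic (i j : 'I_n) :
  antidiag (hyperbolic_vec i) (hyperbolic_vec j) =
  if i != j then 0 else if (i < rev_ord i)%N then 1 else -1.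
Proof.
have antidiagDZ (a b c d : R) (x y z t : V) :
    antidiag (a *: x + b *: y) (c *: z + d *: t) =
    a * c * antidiag x z + a * d * antidiag x t +
    (b * c * antidiag y z + b * d * antidiag y t).
  rewrite antidiagDZl !(antidiagC _ (_ + _)) !antidiagDZl.
  by rewrite !(antidiagC _ z) !(antidiagC _ t); ring.
rewrite /hyperbolic_vec antidiagDZ !antidiag_basis rev_ordK (inj_eq rev_ord_inj).
rewrite (inv_eq rev_ordK) /hyperbolic_coef.
have [<-|ij] := eqVneq i j.
  rewrite -val_eqE /=.
  by case: ltngtP => [lt|gt|eq] /=; rewrite ?mulr1n ?mulr0n; field.
(* Distinct planes are orthogonal, so only the two vectors of one plane remain. *)
have [jr|ij'] := eqVneq j (rev_ord i); last by rewrite oppr0 !mulr0 !addr0.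
rewrite jr rev_ordK; case: ltngtP => [lt|gt|/val_inj eq] /=; try by field.
by rewrite jr -eq eqxx in ij.
Qed.

(** Orthogonal vectors of nonzero square are free: pairing a linear relation with one of them
    isolates its coefficient. *)
Lemma hyperbolic_basis : basis_of fullv [tuple hyperbolic_vec i | i < n].
Proof.
set X := [tuple _ | _ < n]; have XE (i : 'I_n) : X`_i = hyperbolic_vec i.
  by rewrite -tnth_nth tnth_mktuple.
rewrite basisEfree subvf size_tuple (size_basis be) leqnn !andbT.
apply/freeP => k k0 j.
have : antidiag (\sum_i k i *: X`_i) X`_j = k j * antidiag X`_j X`_j.
  rewrite antidiag_suml (bigD1 j)// big1 => [|i /= ij]; last first.
    by rewrite !XE antidiag_hyperbolic ij mulr0.
  exact: addr0.
rewrite k0 linear0l XE antidiag_hyperbolic eqxx /= => /esym/eqP.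
by rewrite mulf_eq0 => /orP[/eqP//|]; case: ifP; rewrite ?oppr_eq0 oner_eq0.
Qed.

End AntidiagonalForm.

Lemma antidiag_signature (R : realType) (V : vectType R) (n p q : nat)
    (e : n.-tuple V) : basis_of fullv e -> n = (p + q)%N -> (p <= q <= p.+1)%N ->
  has_signature (antidiag e) p q.
Proof.
move=> be En /andP[pq qp]; subst n.
exists [tuple hyperbolic_vec e i | i < p + q]; first exact: hyperbolic_basis.
move=> i j; rewrite -!tnth_nth !tnth_mktuple antidiag_hyperbolic//.
(* The left side says 2i + 1 < p + q, which amounts to i < p since q is p or p + 1. *)
case: eqP => // _ /=; suff -> : (i < p + q - i.+1)%N = (i < p)%N by [].
by have := ltn_ord i; lia.
Qed.

(** * The weights and the degeneration of the bracket to 0 *)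

Definition exp2_weight (n : nat) (i : 'I_n) : int :=
  (2 ^ rev_ord i)%:Z - (2 ^ i)%:Z.

Lemma exp2_weight_rev (n : nat) (i : 'I_n) :
  exp2_weight (rev_ord i) = - exp2_weight i.
Proof. by rewrite /exp2_weight rev_ordK opprB. Qed.

(** For i < j < k, 2^i + 2^j <= 2^(j+1) <= 2^k, and strictness comes from the reversed powers:
    2^(n-1-k) < 2^(n-1-j). *)
Lemma exp2_weight_gt0 (n : nat) (i j k : 'I_n) : (i < k)%N -> (j < k)%N -> i != j ->
  0 < exp2_weight i + exp2_weight j - exp2_weight k.
Proof.
wlog ltij : i j / (i < j)%N => [W ik jk ij|_ ltjk _].
  have [lt|gt|eq] := ltngtP i j; first exact: W.
  - have := W j i gt jk ik; rewrite eq_sym => /(_ ij).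
    by rewrite [X in X - _]addrC.
  - by move: ij; rewrite -val_eqE /= eq eqxx.
have rjk : (2 ^ rev_ord k < 2 ^ rev_ord j)%N.
  by rewrite ltn_exp2l//= ltn_sub2l// (leq_trans _ (ltn_ord k)).
have kij : (2 ^ i + 2 ^ j <= 2 ^ k)%N.
  rewrite (@leq_trans (2 ^ j.+1)) ?leq_exp2l// expnS mul2n -addnn leq_add2r.
  by rewrite leq_exp2l// ltnW.
rewrite /exp2_weight; lia.
Qed.

Section WeightAction.
Variables (R : realType) (V : vectType R) (n : nat) (e : n.-tuple V).
Hypothesis be : basis_of fullv e.

Lemma orthogonal_weight (t : R) : 0 < t ->
  orthogonal_group (antidiag e) (diag_end e (fun i => t ^ exp2_weight i)).
Proof.
move=> t_gt0; split.
  have [] := @diag_end_inv _ _ _ _ be (fun i => t ^ (- exp2_weight i))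
    (fun i => t ^ exp2_weight i) => // i.
  by rewrite -expfzDr ?gt_eqF// addNr expr0z.
move=> x y; rewrite !antidiagE; congr (- _); apply: eq_bigr => i _.
rewrite !coord_diag_end// exp2_weight_rev mulrACA -expfzDr ?gt_eqF//.
by rewrite subrr expr0z mul1r.
Qed.

Lemma null_cone_antidiag (mu : bilmap V) : lie_bracket mu ->
  (forall x (j : 'I_n), mu x e`_j \in <<drop j.+1 e>>%VS) ->
  null_cone (antidiag e) mu.
Proof.
move=> mu_lie nil_e; split=> //.
pose s (ijk : 'I_n * 'I_n * 'I_n) :=
  exp2_weight ijk.1.1 + exp2_weight ijk.1.2 - exp2_weight ijk.2.
apply: (@closure_fin_dim_top0 _ _ _ s (bil_component e mu)) => [|t t_gt0].
  move=> [[i j] k]; rewrite /s /= => s_le0.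
  apply/lfunP => x; apply/lfunP => y; rewrite bil_componentE !zero_lfunE.
  (* A nonpositive exponent must belong to a vanishing structure constant. *)
  suff c0 : coord e k (mu e`_i e`_j) = 0.
    rewrite !coord_projE [mu (_ *: _)]linearZ scale_lfunE [mu _ (_ *: _)]linearZ.
    by rewrite !linearZ /= c0 !mulr0 scale0r.
  have mu0 x' (l : 'I_n) : (k <= l)%N -> coord e k (mu x' e`_l) = 0.
    by move=> kl; apply: (coord_drop be (nil_e x' l)); rewrite ltnS.
  have [mu_skew _] := mu_lie.
  (* The adapted basis settles k <= j, skew-symmetry transfers this to k <= i and kills i = j; in
     the remaining case the exponent is positive, a contradiction. *)
  have [kj|jk] := leqP k j; first exact: mu0.
  have [ki|ik] := leqP k i; first by rewrite mu_skew linearN /= mu0// oppr0.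
  have [<-|ij] := eqVneq i j.
    have /eqP := mu_skew e`_i e`_i.
    rewrite -addr_eq0 -mulr2n -scaler_nat scaler_eq0 pnatr_eq0 => /eqP->.
    exact: linear0.
  by have := exp2_weight_gt0 ik jk ij; rewrite ltNge s_le0.
exists (diag_end e (fun i => t ^ exp2_weight i)); first exact: orthogonal_weight.
rewrite (@act_diag_end _ _ _ _ be (fun i => t ^ (- exp2_weight i))) => [|i].
  by apply: eq_bigr => ijk _; rewrite !expfzDr ?gt_eqF.
by rewrite -expfzDr ?gt_eqF// addNr expr0z.
Qed.

End WeightAction.

Theorem proposition6p1 (R : realType) (V : vectType R) (mu : bilmap V)
    (mu_lie : lie_bracket mu) (mu_nil : nilpotent mu)
    (dimV : (3 <= \dim {:V})%N) :
  exists g : {symmetric V},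
    [/\ nondegenerate g,
        forall p : nat, \dim {:V} = p.*2 -> has_signature g p p,
        forall p : nat, \dim {:V} = p.*2.+1 -> has_signature g p p.+1 &
        null_cone g mu].
Proof.
have [e be nil_e] := adapted_basis mu_nil.
exists (antidiag e); split.
- exact: antidiag_nondegenerate.
- by move=> p dimp; apply: antidiag_signature; rewrite ?leqnn ?leqnSn ?addnn.
- by move=> p dimp; apply: antidiag_signature; rewrite ?leqnn ?leqnSn ?addnS ?addnn.
- exact: null_cone_antidiag.
Qed.
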